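(* There exists a polynomial time algorithm that, given a non-negative $L$-smooth function $F\colon[0,1]^{\mathcal N}\to\mathbb R_{\ge0}$, a solvable convex body $P\subseteq[0,1]^{\mathcal N}$ of diameter $D$ and a value $\delta\in(0,1)$, outputs a vector $\mathbf x\in P$ such that \[\langle\mathbf y-\mathbf x,\nabla F(\mathbf x)\rangle\le\delta\cdot\Big[\max_{\mathbf y'\in P}F(\mathbf y')+D^2L/2\Big]\quad\text{for every }\mathbf y\in P.\] If, in addition, $F$ is DR-submodular, this implies \[F(\mathbf x)\ge\tfrac12\max_{\mathbf y\in P}[F(\mathbf x\vee\mathbf y)+F(\mathbf x\wedge\mathbf y)]-\frac{\delta\,[2\max_{\mathbf y'\in P}F(\mathbf y')+D^2L]}{4}.\]
   Context: $\mathcal N$ is a finite set; $F$ is differentiable and the algorithm may evaluate $F$ and $\nabla F$ (it does not need to know $L$). $F$ is $L$-smooth if $\|\nabla F(\mathbf x)-\nabla F(\mathbf y)\|_2\le L\|\mathbf x-\mathbf y\|_2$ for all $\mathbf x,\mathbf y$. $P$ is solvable if linear functions can be optimized over $P$ efficiently; $P$ has diameter $D$ if $\|\mathbf x-\mathbf y\|_2\le D$ for all $\mathbf x,\mathbf y\in P$. $F$ is DR-submodular if $F(\mathbf x+z\mathbf 1_u)-F(\mathbf x)\ge F(\mathbf y+z\mathbf 1_u)-F(\mathbf y)$ for every $u$, every $\mathbf x\le\mathbf y$ in $[0,1]^{\mathcal N}$ and $z\in[0,1-y_u]$. $\vee,\wedge$ denote coordinate-wise maximum and minimum. *)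

(* Defs.v *)
From HB Require Import structures.
From mathcomp Require Import all_boot all_order all_algebra.
From mathcomp Require Import all_classical all_reals all_analysis.
Import Order.TTheory GRing.Theory Num.Theory.
Import numFieldNormedType.Exports.

Set Implicit Arguments.
Unset Strict Implicit.
Unset Printing Implicit Defensive.

Local Open Scope classical_set_scope.
Local Open Scope ring_scope.

(* The ground set is {0, ..., n-1}; a vector of [0,1]^N is a row vector.
   The library norm `|x| on 'rV[R]_n is the sup norm, hence norm2. *)

Definition dotv (R : realType) (n : nat) (x y : 'rV[R]_n) : R :=
  \sum_(i < n) x 0 i * y 0 i.

Definition norm2 (R : realType) (n : nat) (x : 'rV[R]_n) : R :=
  Num.sqrt (dotv x x).

Definition cube (R : realType) (n : nat) : set 'rV[R]_n :=
  [set x | forall i, 0 <= x 0 i <= 1].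
Arguments cube {R n}.

Definition vee (R : realType) (n : nat) (x y : 'rV[R]_n) : 'rV[R]_n :=
  map2_mx Num.max x y.

Definition wedge (R : realType) (n : nat) (x y : 'rV[R]_n) : 'rV[R]_n :=
  map2_mx Num.min x y.

(* Functions on the cube are total functions on 'rV[R]_n of which only the
   values on the cube matter.  The derivative is taken relative to the cube, so
   that it makes sense on its boundary too; since the cube has nonempty interior
   and is convex, g is uniquely determined on the cube by F. *)
Definition is_gradient (R : realType) (n : nat)
    (F : 'rV[R]_n -> R) (g : 'rV[R]_n -> 'rV[R]_n) : Prop :=
  forall x, cube x -> forall e : R, 0 < e ->
    \forall y \near x, cube y ->
      `|F y - F x - dotv (g x) (y - x)| <= e * norm2 (y - x).

Definition L_smooth (R : realType) (n : nat)
    (g : 'rV[R]_n -> 'rV[R]_n) (L : R) : Prop :=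
  forall x y, cube x -> cube y -> norm2 (g x - g y) <= L * norm2 (x - y).

Definition DR_submodular (R : realType) (n : nat) (F : 'rV[R]_n -> R) : Prop :=
  forall (u : 'I_n) (x y : 'rV[R]_n) (z : R),
    cube x -> cube y -> (forall i, x 0 i <= y 0 i) -> 0 <= z <= 1 - y 0 u ->
    F (y + z *: delta_mx 0 u) - F y <= F (x + z *: delta_mx 0 u) - F x.

(* No interior point is required: lower-dimensional bodies are allowed. *)
Definition convex_body (R : realType) (n : nat) (P : set 'rV[R]_n) : Prop :=
  [/\ P !=set0, compact P & convex_set (P : set (convex_lmodType 'rV[R]_n))].

Definition has_diameter (R : realType) (n : nat)
    (P : set 'rV[R]_n) (D : R) : Prop :=
  forall x y, P x -> P y -> norm2 (x - y) <= D.

Definition linear_optimizer (R : realType) (n : nat)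
    (P : set 'rV[R]_n) (lin : 'rV[R]_n -> 'rV[R]_n) : Prop :=
  forall w, P (lin w) /\ forall y, P y -> dotv w y <= dotv w (lin w).

Definition is_max_on (T : Type) (R : realType)
    (A : set T) (f : T -> R) (M : R) : Prop :=
  (exists2 y, A y & f y = M) /\ forall y, A y -> f y <= M.

(* Model of computation: while programs over a real RAM.  A state consists of
   natural-number registers (used for counters and addresses), real registers,
   and an array of reals addressed by natural numbers.  Arithmetic on reals is
   exact.  Natural numbers have no multiplication and reals have no rounding,
   since either operation at unit cost would make the model too powerful.
   Programs do not mention R or n: one program serves all inputs. *)

Inductive iexp : Type :=
| IVar of nat
| ICst of nat
| IAdd of iexp & iexp
| ISub of iexp & iexp.

Inductive rexp : Type :=
| RVar of nat
| RCst of nat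
| RMem of iexp
| RAdd of rexp & rexp
| RSub of rexp & rexp
| RMul of rexp & rexp
| RDiv of rexp & rexp.

Inductive bexp : Type :=
| BIlt of iexp & iexp
| BRlt of rexp & rexp
| BNot of bexp.

Inductive cmd : Type :=
| Skip
| ISet of nat & iexp
| RSet of nat & rexp
| Store of iexp & rexp
| CallF of nat & iexp
| CallGrad of iexp & iexp
| CallLin of iexp & iexp
| Seq of cmd & cmd
| If of bexp & cmd & cmd
| While of bexp & cmd.

Record state (R : realType) : Type := State {
  ireg : nat -> nat;
  rreg : nat -> R;
  mem : nat -> R
}.

Record oracles (R : realType) (n : nat) : Type := Oracles {
  orF : 'rV[R]_n -> R;
  orGrad : 'rV[R]_n -> 'rV[R]_n;
  orLin : 'rV[R]_n -> 'rV[R]_n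
}.

Fixpoint ieval (R : realType) (s : state R) (e : iexp) : nat :=
  match e with
  | IVar v => ireg s v
  | ICst c => c
  | IAdd e1 e2 => (ieval s e1 + ieval s e2)%N
  | ISub e1 e2 => (ieval s e1 - ieval s e2)%N
  end.

Fixpoint reval (R : realType) (s : state R) (e : rexp) : R :=
  match e with
  | RVar v => rreg s v
  | RCst c => c%:R
  | RMem a => mem s (ieval s a)
  | RAdd e1 e2 => reval s e1 + reval s e2
  | RSub e1 e2 => reval s e1 - reval s e2
  | RMul e1 e2 => reval s e1 * reval s e2
  | RDiv e1 e2 => reval s e1 / reval s e2
  end.

Fixpoint beval (R : realType) (s : state R) (b : bexp) : bool :=
  match b with
  | BIlt e1 e2 => (ieval s e1 < ieval s e2)%N
  | BRlt e1 e2 => reval s e1 < reval s e2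
  | BNot b1 => ~~ beval s b1
  end.

(* Evaluating an expression costs one unit per node. *)

Fixpoint icost (e : iexp) : nat :=
  match e with
  | IVar _ | ICst _ => 1
  | IAdd e1 e2 | ISub e1 e2 => (icost e1 + icost e2)%N.+1
  end.

Fixpoint rcost (e : rexp) : nat :=
  match e with
  | RVar _ | RCst _ => 1
  | RMem a => (icost a).+1
  | RAdd e1 e2 | RSub e1 e2 | RMul e1 e2 | RDiv e1 e2 =>
      (rcost e1 + rcost e2)%N.+1
  end.

Fixpoint bcost (b : bexp) : nat :=
  match b with
  | BIlt e1 e2 => (icost e1 + icost e2)%N.+1
  | BRlt e1 e2 => (rcost e1 + rcost e2)%N.+1
  | BNot b1 => (bcost b1).+1
  end.

Definition set_ireg (R : realType) (s : state R) (v k : nat) : state R :=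
  State [eta ireg s with v |-> k] (rreg s) (mem s).

Definition set_rreg (R : realType) (s : state R) (v : nat) (r : R) : state R :=
  State (ireg s) [eta rreg s with v |-> r] (mem s).

Definition set_mem (R : realType) (s : state R) (a : nat) (r : R) : state R :=
  State (ireg s) (rreg s) [eta mem s with a |-> r].

(* The vector stored in the cells a, ..., a + n - 1. *)
Definition get_vec (R : realType) (n : nat) (s : state R) (a : nat) :
    'rV[R]_n :=
  \row_(i < n) mem s (a + i)%N.

Definition set_vec (R : realType) (n : nat) (s : state R) (a : nat)
    (x : 'rV[R]_n) : state R :=
  State (ireg s) (rreg s)
    (fun k => if (a <= k)%N then
                if insub (k - a)%N is Some i then x 0 i else mem s k
              else mem s k).

(* exec O c s t s': started in s, c terminates in s' after t steps.  An oracle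
   call costs n + 1 steps on top of its address computations.  F and its
   gradient can be queried only at points of the cube: elsewhere the run is
   stuck. *)
Inductive exec (R : realType) (n : nat) (O : oracles R n) :
    cmd -> state R -> nat -> state R -> Prop :=
| ExSkip s : exec O Skip s 1 s
| ExISet s v e :
    exec O (ISet v e) s (icost e).+1 (set_ireg s v (ieval s e))
| ExRSet s v e :
    exec O (RSet v e) s (rcost e).+1 (set_rreg s v (reval s e))
| ExStore s a e :
    exec O (Store a e) s (icost a + rcost e)%N.+1
      (set_mem s (ieval s a) (reval s e))
| ExCallF s v a : cube (get_vec n s (ieval s a)) ->
    exec O (CallF v a) s (icost a + n)%N.+1
      (set_rreg s v (orF O (get_vec n s (ieval s a))))
| ExCallGrad s b a : cube (get_vec n s (ieval s a)) ->
    exec O (CallGrad b a) s (icost b + icost a + n)%N.+1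
      (set_vec s (ieval s b) (orGrad O (get_vec n s (ieval s a))))
| ExCallLin s b a :
    exec O (CallLin b a) s (icost b + icost a + n)%N.+1
      (set_vec s (ieval s b) (orLin O (get_vec n s (ieval s a))))
| ExSeq c1 c2 s1 s2 s3 t1 t2 :
    exec O c1 s1 t1 s2 -> exec O c2 s2 t2 s3 ->
    exec O (Seq c1 c2) s1 (t1 + t2)%N s3
| ExIfTrue b c1 c2 s s' t : beval s b -> exec O c1 s t s' ->
    exec O (If b c1 c2) s (bcost b + t)%N.+1 s'
| ExIfFalse b c1 c2 s s' t : ~~ beval s b -> exec O c2 s t s' ->
    exec O (If b c1 c2) s (bcost b + t)%N.+1 s'
| ExWhileTrue b c s1 s2 s3 t1 t2 : beval s1 b ->
    exec O c s1 t1 s2 -> exec O (While b c) s2 t2 s3 ->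
    exec O (While b c) s1 (bcost b + t1 + t2)%N.+1 s3
| ExWhileFalse b c s : ~~ beval s b ->
    exec O (While b c) s (bcost b).+1 s.

(* The input is n and delta; the output vector is read off the cells
   0, ..., n - 1. *)

Definition init_state (R : realType) (n : nat) (delta : R) : state R :=
  State [eta fun=> 0%N with 0%N |-> n] [eta fun=> 0 with 0%N |-> delta]
    (fun=> 0).

Definition output (R : realType) (n : nat) (s : state R) : 'rV[R]_n :=
  get_vec n s 0.

(* Main.v *)
(* The algorithm is Frank-Wolfe with constant step delta,
   x <- x + delta (lin (grad F x) - x), which outputs the iterate x whose gap
   max_(y in P) <y - x, grad F x> = <lin (grad F x) - x, grad F x> is smallest.
   By smoothness a step of gap G raises F by at least
   delta G - delta^2 D^2 L / 2.  If all gaps exceeded delta (M + D^2 L / 2),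
   each step would raise F by more than delta^2 M, hence F, which starts
   nonnegative, would exceed its maximum M after delta^-2 steps.

   For a DR-submodular F the gradient is antitone, so F lies below its tangent
   at x along the nonnegative direction [vee x y - x] and the nonpositive
   direction [wedge x y - x]; these directions add up to y - x. *)
Require Import Defs.
From HB Require Import structures.
From mathcomp Require Import all_boot all_order all_algebra.
From mathcomp Require Import all_classical all_reals all_analysis.
From mathcomp Require Import ring lra zify.
Import Order.TTheory GRing.Theory Num.Theory.
Import numFieldNormedType.Exports.
Local Open Scope classical_set_scope.
Local Open Scope ring_scope.

Set Implicit Arguments.
Unset Strict Implicit.
Unset Printing Implicit Defensive.

(** * Calculus on the cube *)

Section Euclidean.
Variables (R : realType) (n : nat).
Implicit Types (x y v : 'rV[R]_n) (a : R).

Lemma dotvC x y : dotv x y = dotv y x.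
Proof. by apply: eq_bigr => i _; rewrite mulrC. Qed.

Lemma dotvDl x y v : dotv (x + y) v = dotv x v + dotv y v.
Proof.
by rewrite /dotv -big_split; apply: eq_bigr => i _; rewrite mxE mulrDl.
Qed.

Lemma dotvZl a x y : dotv (a *: x) y = a * dotv x y.
Proof.
by rewrite /dotv mulr_sumr; apply: eq_bigr => i _; rewrite mxE mulrA.
Qed.

Lemma dotvBl x y v : dotv (x - y) v = dotv x v - dotv y v.
Proof. by rewrite -(scaleN1r y) dotvDl dotvZl mulN1r. Qed.

Lemma dotvDr x y v : dotv v (x + y) = dotv v x + dotv v y.
Proof. by rewrite !(dotvC v) dotvDl. Qed.

Lemma dotvBr x y v : dotv v (x - y) = dotv v x - dotv v y.
Proof. by rewrite !(dotvC v) dotvBl. Qed.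

Lemma dotvZr a x y : dotv x (a *: y) = a * dotv x y.
Proof. by rewrite !(dotvC x) dotvZl. Qed.

Lemma dotv_delta x (u : 'I_n) : dotv x (delta_mx 0 u) = x 0 u.
Proof.
rewrite /dotv (bigD1 u) //= mxE !eqxx mulr1 big1 ?addr0 // => i iu.
by rewrite mxE (negPf iu) andbF mulr0.
Qed.

Lemma dotvv_ge0 x : 0 <= dotv x x.
Proof. by apply: sumr_ge0 => i _; rewrite -expr2 sqr_ge0. Qed.

Lemma norm2_ge0 x : 0 <= norm2 x.
Proof. exact: sqrtr_ge0. Qed.

Lemma norm2Z a x : norm2 (a *: x) = `|a| * norm2 x.
Proof.
by rewrite /norm2 dotvZl dotvZr mulrA -expr2 sqrtrM ?sqr_ge0 // sqrtr_sqr.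
Qed.

(** For nonzero [y] the squared norm of <y,y> x - <x,y> y equals <y,y> (<x,x> <y,y> - <x,y>^2), and
    it is nonnegative. *)
Lemma cauchy_schwarz x y : `|dotv x y| <= norm2 x * norm2 y.
Proof.
suff bac : dotv x y ^+ 2 <= dotv x x * dotv y y.
  by rewrite -sqrtr_sqr -sqrtrM ?dotvv_ge0 // ler_sqrt // mulr_ge0 ?dotvv_ge0.
have := dotvv_ge0 y; rewrite le_eqVlt => /orP[/eqP y0|y_gt0].
  suff -> : dotv x y = 0 by rewrite expr0n mulr_ge0 ?dotvv_ge0.
  rewrite /dotv big1 // => i _; apply/eqP; rewrite mulf_eq0; apply/orP; right.
  have /psumr_eq0P H : forall j : 'I_n, true -> 0 <= y 0 j * y 0 j.
    by move=> j _; rewrite -expr2 sqr_ge0.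
  by have /eqP := H (esym y0) i isT; rewrite mulf_eq0 orbb.
have := dotvv_ge0 (dotv y y *: x - dotv x y *: y).
rewrite !(dotvBl, dotvBr, dotvZl, dotvZr) (dotvC y x) => H.
by rewrite -(ler_pM2l y_gt0) -subr_ge0; apply: le_trans H _; lra.
Qed.

(** Bridges neighbourhoods, which are taken in the sup norm, and the error terms of [is_gradient],
    which are Euclidean; the crude factor [n] is enough for continuity. *)
Lemma norm2_le_norm x : norm2 x <= n%:R * `|x|.
Proof.
have xi i : `|x 0 i| <= `|x|.
  rewrite [X in _ <= X]/Num.Def.normr /= mx_normrE.
  by rewrite (le_bigmax_cond _ (fun ij => `|x ij.1 ij.2|) (j := (0, i))).
rewrite -[X in _ <= X]ger0_norm ?mulr_ge0 // -sqrtr_sqr ler_sqrt ?sqr_ge0 //.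
apply: (@le_trans _ _ (\sum_(i < n) `|x| ^+ 2)).
  apply: ler_sum => i _; rewrite -expr2 -real_normK ?num_real //.
  by rewrite lerXn2r ?nnegrE.
rewrite sumr_const card_ord exprMn -[X in X <= _]mulr_natl.
rewrite ler_wpM2r ?sqr_ge0 //.
by rewrite -natrX ler_nat expnS expn1; case: (n) => // m; rewrite leq_pmulr.
Qed.

End Euclidean.

Lemma within_continuousP (T : topologicalType) (R : realType) (A : set T)
    (f : T -> R) :
  (forall x, A x -> forall e : R, 0 < e ->
    \forall y \near x, A y -> `|f y - f x| <= e) ->
  {within A, continuous f}.
Proof.
move=> H; apply/subspace_continuousP => x Ax.
by apply/cvgrPdist_le => e e0; near=> y do rewrite distrC; exact: H.
Unshelve. all: by end_near. Qed.

Section OnTheCube.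
Variables (R : realType) (n : nat).
Implicit Types (x y v : 'rV[R]_n) (A : set 'rV[R]_n).

Lemma cube_segment x v (t : R) :
  cube x -> cube (x + v) -> 0 <= t <= 1 -> cube (x + t *: v).
Proof.
move=> cx cxv /andP[t0 t1] i; have /andP[x0 x1] := cx i.
have := cxv i; rewrite !mxE => /andP[v0 v1]; apply/andP; split; nra.
Qed.

Lemma is_gradient_continuous (F : 'rV[R]_n -> R) g x (e : R) :
  is_gradient F g -> cube x -> 0 < e ->
  \forall y \near x, cube y -> `|F y - F x| <= e.
Proof.
move=> Fg cx e0.
(* A Lipschitz constant at [x] for the sup norm: the gradient estimate with error 1 gives the factor
   [norm2 (g x) + 1]. Taking [n.+1] instead of [n] keeps [K] positive in dimension 0. *)
set K := (norm2 (g x) + 1) * n.+1%:R.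
have K0 : 0 < K by rewrite mulr_gt0 ?ltr_wpDl ?norm2_ge0.
near=> y => cy.
have yx : `|y - x| <= e / K.
  by near: y; apply: cvgr_distC_le => //; exact: divr_gt0.
have := cauchy_schwarz (g x) (y - x).
have H : `|F y - F x - dotv (g x) (y - x)| <= 1 * norm2 (y - x).
  by move: cy; near: y; exact: Fg.
have N : norm2 (y - x) <= n.+1%:R * `|y - x|.
  by apply: le_trans (norm2_le_norm _) _; rewrite ler_wpM2r // ler_nat.
move=> CS; rewrite -(subrK (dotv (g x) (y - x)) (F y - F x)).
apply: le_trans (ler_normD _ _) _.
apply: (@le_trans _ _ ((norm2 (g x) + 1) * norm2 (y - x))); first by lra.
apply: (@le_trans _ _ (K * `|y - x|)).
  by rewrite -mulrA ler_wpM2l // addr_ge0 ?norm2_ge0.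
by rewrite mulrC -ler_pdivlMr.
Unshelve. all: by end_near. Qed.

Lemma line_continuous x v : continuous (fun h : R => x + h *: v).
Proof.
by move=> t; apply: cvgD; [exact: cvg_cst|exact: (@scalel_continuous R)].
Qed.

(** The estimate is relative to the unit interval, so it yields both the two-sided derivative at
    interior [t] and the right derivative at 0. *)
Lemma is_gradient_line (F : 'rV[R]_n -> R) g x v (t e : R) :
  is_gradient F g -> cube x -> cube (x + v) -> 0 <= t <= 1 -> 0 < e ->
  \forall h \near t, 0 <= h <= 1 ->
    `|F (x + h *: v) - F (x + t *: v) - (h - t) * dotv (g (x + t *: v)) v|
      <= e * `|h - t|.
Proof.
move=> Fg cx cxv t01 e0.
(* The added 1 keeps the divisor positive when [v] is zero. *)
have N0 : 0 < norm2 v + 1 by rewrite ltr_wpDl ?norm2_ge0.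
have H := @line_continuous x v t _
  (Fg _ (cube_segment cx cxv t01) _ (divr_gt0 e0 N0)).
near=> h => h01.
have : `|F (x + h *: v) - F (x + t *: v) -
    dotv (g (x + t *: v)) (x + h *: v - (x + t *: v))|
    <= e / (norm2 v + 1) * norm2 (x + h *: v - (x + t *: v)).
  by have := cube_segment cx cxv h01; near: h; exact: H.
have -> : x + h *: v - (x + t *: v) = (h - t) *: v.
  by rewrite scalerBl opprD addrACA subrr add0r.
rewrite dotvZr norm2Z => /le_trans; apply.
rewrite mulrAC ler_pdivrMr // -!mulrA ler_pM2l // ler_wpM2l //.
by rewrite lerDl.
Unshelve. all: by end_near. Qed.

(** The mean value theorem for F(x + t v) + b t^2. The quadratic term gives the sharp constant L/2
    for smooth functions without integration; [b = 0] is the usual mean value theorem. *)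
Lemma gradient_mean_value (F : 'rV[R]_n -> R) g x v (b : R) :
  is_gradient F g -> cube x -> cube (x + v) ->
  exists2 c : R, 0 < c < 1 &
    F (x + v) - F x + b = dotv (g (x + c *: v)) v + 2 * b * c.
Proof.
move=> Fg cx cxv.
pose f t := F (x + t *: v).
pose h t := f t + b * t ^+ 2.
have near_in01 (t : R) : 0 < t < 1 -> \forall s \near t, 0 <= s <= 1.
  move=> t01; have : t \in `]0, 1[ by rewrite in_itv.
  by move=> /near_in_itvoo; apply: filterS => s /=; rewrite in_itv /= =>
    /andP[s0 s1]; rewrite !ltW.
have df (t : R) : t \in `]0, 1[ -> is_derive t 1 f (dotv (g (x + t *: v)) v).
  rewrite in_itv /= => t01.
  have t01' : 0 <= t <= 1 by case/andP: t01 => t0 t1; rewrite !ltW.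
  have shift_t : (fun k : R => k + t) @ (0 : R) --> t.
      rewrite -[X in _ --> X]add0r.
      by apply: cvgD; [exact: cvg_id|exact: cvg_cst].
    have : (fun h => h^-1 *: ((f \o shift t) (h *: 1) - f t)) @ 0^' -->
         dotv (g (x + t *: v)) v.
    apply/cvgrPdist_le => e e0; near=> k.
    have k0 : k != 0 by near: k; exact: nbhs_dnbhs_neq.
    rewrite /= distrC /GRing.scale /= mulr1.
    have : 0 <= k + t <= 1 ->
       `|F (x + (k + t) *: v) - F (x + t *: v)
          - (k + t - t) * dotv (g (x + t *: v)) v| <= e * `|k + t - t|.
      near: k; apply: nbhs_dnbhs.
      exact: (shift_t _ (is_gradient_line Fg cx cxv t01' e0)).
    rewrite addrK -/(f _) -/(f _) => H.
    have {}H : `|f (k + t) - f t - k * dotv (g (x + t *: v)) v| <= e * `|k|.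
      apply: H; near: k; apply: nbhs_dnbhs.
      exact: (shift_t _ (near_in01 _ t01)).
    (* Multiplying by |k| turns the estimate on the difference quotient into the one on
       increments. *)
    rewrite -(ler_pM2r (x := `|k|)) ?normr_gt0 // -normrM mulrBl mulrAC.
    by rewrite mulVf // mul1r (mulrC _ k).
  move=> H; apply: DeriveDef; last exact: cvg_lim.
  by apply/cvg_ex; eexists; exact: H.
have dh (t : R) : t \in `]0, 1[ ->
    is_derive t 1 h (dotv (g (x + t *: v)) v + 2 * b * t).
  move=> /df dft; apply: is_derive_eq.
  by rewrite -[t%:A]/(t * 1) -[b *: _]/(b * _); ring.
have ch : {within `[0, 1], continuous h}.
  apply: within_continuousP => t; rewrite /= in_itv /= => t01 e e0.
  have cf : \forall s \near t, cube (x + s *: v) -> `|f s - f t| <= e / 2.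
    exact: (line_continuous (is_gradient_continuous Fg
      (cube_segment cx cxv t01) (divr_gt0 e0 (ltr0Sn _ 1)))).
  have cq : (fun s : R => b * s ^+ 2) @ t --> b * t ^+ 2.
    by apply: cvgMl_tmp; exact: exprn_continuous.
  near=> s; rewrite in_itv /= => s01.
  have H1 : `|f s - f t| <= e / 2.
    by have := cube_segment cx cxv s01; near: s; exact: cf.
  have H2 : `|b * s ^+ 2 - b * t ^+ 2| <= e / 2.
    near: s; move: (e / 2) (divr_gt0 e0 (ltr0Sn _ 1)); exact/cvgrPdistC_le.
  have -> : h s - h t = (f s - f t) + (b * s ^+ 2 - b * t ^+ 2).
    by rewrite /h; ring.
  by apply: le_trans (ler_normD _ _) _; lra.
have [c c01 E] := MVT ltr01 dh ch.
exists c; first by move: c01; rewrite in_itv.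
move: E; rewrite subr0 mulr1 => <-; rewrite /h /f scale1r scale0r addr0; ring.
Unshelve. all: by end_near. Qed.

End OnTheCube.

(** * Smooth and DR-submodular functions *)

Section SmoothAndSubmodular.
Variables (R : realType) (n : nat).
Variables (F : 'rV[R]_n -> R) (g : 'rV[R]_n -> 'rV[R]_n).
Implicit Types (x y v : 'rV[R]_n).
Hypothesis Fg : is_gradient F g.

(** Between [x] and [x + c *: v] the gradient changes by at most c L |v|, so Cauchy-Schwarz loses at
    most c L |v|^2. With b = L |v|^2 / 2 this is exactly the term 2 b c. *)
Lemma L_smooth_lower_bound (L : R) x v :
  0 <= L -> L_smooth g L -> cube x -> cube (x + v) ->
  dotv (g x) v - L / 2 * norm2 v ^+ 2 <= F (x + v) - F x.
Proof.
move=> L0 gL cx cxv.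
have [c /andP[c0 c1] E] := gradient_mean_value (L / 2 * norm2 v ^+ 2) Fg cx cxv.
have cxc : cube (x + c *: v) by apply: cube_segment => //; rewrite !ltW.
have := gL _ _ cxc cx.
have -> : x + c *: v - x = c *: v by rewrite addrC addKr.
rewrite norm2Z (gtr0_norm c0) => gc.
have := cauchy_schwarz (g (x + c *: v) - g x) v.
rewrite dotvBl ler_norml => /andP[H _].
have := ler_wpM2r (norm2_ge0 v) gc.
move: E H; set N := norm2 v; lra.
Qed.

Lemma is_gradient_right x v (e : R) :
  cube x -> cube (x + v) -> 0 < e ->
  \forall h \near 0^'+, `|F (x + h *: v) - F x - h * dotv (g x) v| <= e * h.
Proof.
move=> cx cxv e0; have t0 : 0 <= (0 : R) <= 1 by rewrite lexx ler01.
have H := is_gradient_line Fg cx cxv t0 e0.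
near=> h.
have h0 : 0 < h by near: h; exact: nbhs_right_gt.
have h01 : 0 <= h <= 1 by rewrite ltW //=; near: h; exact: nbhs_right_le.
suff : `|F (x + h *: v) - F (x + 0 *: v) - (h - 0) * dotv (g (x + 0 *: v)) v|
      <= e * `|h - 0| by rewrite scale0r addr0 subr0 (gtr0_norm h0).
by have := h01; near: h; apply: cvg_within; exact: H.
Unshelve. all: by end_near. Qed.

(* The last hypothesis leaves room in the cube for difference quotients on the
   same side at [x] and at [y]. *)
Lemma DR_submodular_gradient_antitone x y (u : 'I_n) :
  DR_submodular F -> cube x -> cube y -> (forall i, x 0 i <= y 0 i) ->
  y 0 u < 1 \/ 0 < x 0 u -> g y 0 u <= g x 0 u.
Proof.
move=> DR cx cy xy yx.
have /andP[x0 x1] := cx u; have /andP[y0 y1] := cy u; have xyu := xy u.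
have inc (z : 'rV[R]_n) (w : R) : cube z -> 0 <= z 0 u + w <= 1 ->
    cube (z + w *: delta_mx 0 u).
  move=> cz zw i; rewrite !mxE eqxx /=; case: eqP => [->|_].
    by rewrite mulr1.
  by rewrite mulr0 addr0; exact: cz.
(* The signed room [w] is the distance from [y] to the upper face, or minus the distance from [x] to
   the lower face. Multiplying increments by [w] makes one inequality serve both directions. *)
have [w [w0 xw yw dec]] : exists w : R, [/\ w != 0, 0 <= x 0 u + w <= 1,
    0 <= y 0 u + w <= 1 & forall h, 0 <= h <= 1 ->
      w * (F (y + h *: (w *: delta_mx 0 u)) - F y)
      <= w * (F (x + h *: (w *: delta_mx 0 u)) - F x)].
  case: yx => [yu|xu].
    exists (1 - y 0 u); split; [by rewrite gt_eqF ?subr_gt0| lra | lra |].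
    move=> h /andP[h0 h1]; rewrite !scalerA ler_wpM2l ?subr_ge0 //.
    by apply: DR => //; apply/andP; split; nra.
  exists (- x 0 u); split; [by rewrite oppr_eq0 gt_eqF| lra | lra |].
  move=> h /andP[h0 h1]; rewrite !scalerA ler_wnM2l ?oppr_le0 //.
  (* For downward moves, DR-submodularity is applied at the lowered points, with increments leading
     back up to [x] and [y]. *)
  have back (z : 'rV[R]_n) : z = z + (h * - x 0 u) *: delta_mx 0 u
      + (h * x 0 u) *: delta_mx 0 u.
    by rewrite -addrA -scalerDl mulrN addNr scale0r addr0.
  rewrite -lerN2 !opprB [X in F X - _ <= _]back [X in _ <= F X - _]back.
  apply: DR.
  - by apply: inc => //; nra.
  - by apply: inc => //; nra.
  - by move=> i; rewrite !mxE lerD2r.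
  - by rewrite !mxE !eqxx /= mulr1; nra.
rewrite leNgt; apply/negP => lt_g.
(* With q = w^2 (g y u - g x u) h, each of the two errors costs q/4 after multiplication by |w|, so
   a gap of at least q/2 remains and contradicts [dec]. *)
have [e e_def] : exists e, e = `|w| * (g y 0 u - g x 0 u) / 4 by eexists.
have e0 : 0 < e.
  by rewrite e_def divr_gt0 // mulr_gt0 ?normr_gt0 ?subr_gt0.
near (0 : R)^'+ => h.
have h0 : 0 < h by near: h; exact: nbhs_right_gt.
have h01 : 0 <= h <= 1 by rewrite ltW //=; near: h; exact: nbhs_right_le.
have := dec _ h01.
have : `|F (x + h *: (w *: delta_mx 0 u)) - F x - h * (w * g x 0 u)|
    <= e * h.
  rewrite -dotv_delta -dotvZr.
  by near: h; apply: is_gradient_right => //; exact: inc.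
have : `|F (y + h *: (w *: delta_mx 0 u)) - F y - h * (w * g y 0 u)|
    <= e * h.
  rewrite -dotv_delta -dotvZr.
  by near: h; apply: is_gradient_right => //; exact: inc.
set a := F _ - F y; set b := F _ - F x.
move=> /(ler_wpM2l (normr_ge0 w)); rewrite -normrM => Ha.
move=> /(ler_wpM2l (normr_ge0 w)); rewrite -normrM => Hb.
move=> ab.
have we : `|w| * (e * h) = w ^+ 2 * (g y 0 u - g x 0 u) * h / 4.
  by rewrite e_def -(real_normK (num_real w)); field.
have : 0 < w ^+ 2 * (g y 0 u - g x 0 u) * h.
  by rewrite mulr_gt0 // mulr_gt0 ?subr_gt0 // exprn_even_gt0 //= w0.
move: Ha Hb; rewrite we !ler_norml => /andP[Ha _] /andP[_ Hb].
lra.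
Unshelve. all: by end_near. Qed.

(** By the mean value theorem the increment is the slope at an intermediate point, and antitonicity
    compares it with the slope at [x] coordinate by coordinate. Since 0 < c < 1, a coordinate that
    really moves has the room in the cube that antitonicity asks for. *)
Lemma DR_submodular_gradient_bound x p :
  DR_submodular F -> cube x -> cube p ->
  (forall i, x 0 i <= p 0 i) \/ (forall i, p 0 i <= x 0 i) ->
  F p - F x <= dotv (g x) (p - x).
Proof.
move=> DR cx cp xp.
have cxv : cube (x + (p - x)) by rewrite addrC subrK.
have [c /andP[c0 c1]] := gradient_mean_value 0 Fg cx cxv.
rewrite addr0 mulr0 mul0r addr0 (addrC x (p - x)) subrK => ->.
have cxc : cube (x + c *: (p - x)) by apply: cube_segment => //; rewrite !ltW.
apply: ler_sum => i _; have /andP[x0 x1] := cx i; have /andP[p0 p1] := cp i.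
have [xpi|ne] := eqVneq (x 0 i) (p 0 i).
  by rewrite !mxE xpi subrr !mulr0.
have [vi|vi] := ltrP (x 0 i) (p 0 i).
  rewrite ler_wpM2r ?mxE ?subr_ge0 ?(ltW vi) //.
  (* One strict coordinate decides which alternative of [xp] holds. *)
  have {}xp j : x 0 j <= p 0 j.
    by case: xp => // px; have := lt_le_trans vi (px i); rewrite ltxx.
  apply: DR_submodular_gradient_antitone => //.
    by move=> j; rewrite !mxE lerDl mulr_ge0 ?(ltW c0) // subr_ge0.
  by left; rewrite !mxE; nra.
have {}vi : p 0 i < x 0 i by rewrite lt_neqAle eq_sym ne.
rewrite ler_wnM2r ?mxE ?subr_le0 ?(ltW vi) //.
have {}xp j : p 0 j <= x 0 j.
  by case: xp => // px; have := lt_le_trans vi (px i); rewrite ltxx.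
apply: DR_submodular_gradient_antitone => //.
  by move=> j; rewrite !mxE gerDl mulr_ge0_le0 ?(ltW c0) // subr_le0.
by right; rewrite !mxE; nra.
Qed.

Lemma cube_vee x y : cube x -> cube y -> cube (vee x y).
Proof.
move=> cx cy i; rewrite mxE; have := cx i; have := cy i.
by rewrite /Num.max; case: ifP.
Qed.

Lemma cube_wedge x y : cube x -> cube y -> cube (wedge x y).
Proof.
move=> cx cy i; rewrite mxE; have := cx i; have := cy i.
by rewrite /Num.min; case: ifP.
Qed.

Lemma DR_submodular_vee_wedge x y :
  DR_submodular F -> cube x -> cube y ->
  F (vee x y) + F (wedge x y) - 2 * F x <= dotv (y - x) (g x).
Proof.
move=> DR cx cy.
have Hv : F (vee x y) - F x <= dotv (g x) (vee x y - x).
  apply: DR_submodular_gradient_bound => //; first exact: cube_vee.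
  by left=> i; rewrite mxE le_max lexx.
have Hw : F (wedge x y) - F x <= dotv (g x) (wedge x y - x).
  apply: DR_submodular_gradient_bound => //; first exact: cube_wedge.
  by right=> i; rewrite mxE ge_min lexx.
have -> : y - x = (vee x y - x) + (wedge x y - x).
  by apply/rowP => i; rewrite !mxE; have := addr_max_min (x 0 i) (y 0 i); lra.
rewrite dotvC dotvDr; lra.
Qed.

End SmoothAndSubmodular.

(** * Compactness and continuity *)

Lemma exists_is_max_on (T : topologicalType) (R : realType) (A : set T)
    (f : T -> R) :
  A !=set0 -> compact A -> {within A, continuous f} ->
  exists M, is_max_on A f M.
Proof.
move=> A0 cA cf; have [c cA' cmax] := compact_EVT_max A0 cA cf.
exists (f c); split; first by exists c => //; exact: set_mem.
by move=> y Ay; apply: cmax; exact: mem_set.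
Qed.

(** Meant for [vee x] and [wedge x]; a coordinatewise bound suffices because the norm is the sup
    norm. *)
Lemma nonexpansive_continuous (R : realType) (n : nat)
    (f : 'rV[R]_n -> 'rV[R]_n) :
  (forall y z i, `|f y 0 i - f z 0 i| <= `|y 0 i - z 0 i|) -> continuous f.
Proof.
move=> H y; apply/(cvgrPdist_le (FF := nbhs_filter y)) => e e0; near=> z.
have : `|y - z| <= e by rewrite distrC; near: z; apply: cvgr_distC_le => //.
apply: le_trans; rewrite /Num.Def.normr /= !mx_normrE.
apply: le_bigmax2 => -[i j] _ /=; rewrite (ord1 i).
by have := H y z j; rewrite !mxE.
Unshelve. all: by end_near. Qed.

(** * Program logic *)

(* [mem] would otherwise denote the collective predicate of ssrbool. *)
Import Defs.

(** Register 0 holds n and register 1 the loop counter i, so these address k n + i and k n. Repeated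
    addition replaces the missing multiplication; [k] is a fixed numeral, so the cost does not
    depend on n. *)
Definition addr (k : nat) : iexp := iter k (IAdd (IVar 0)) (IVar 1).
Definition base (k : nat) : iexp := iter k (IAdd (IVar 0)) (ICst 0).

Definition for_loop (c : cmd) : cmd :=
  Seq (ISet 1 (ICst 0))
    (While (BIlt (IVar 1) (IVar 0)) (Seq c (ISet 1 (IAdd (IVar 1) (ICst 1))))).

Section ProgramLogic.
Variables (R : realType) (n : nat) (O : oracles R n).
Implicit Types (s : state R) (c : cmd) (Q : state R -> Prop).

(** A total-correctness triple in which [T] only bounds the time, so that costs can be rounded
    up. *)
Definition reaches c s (T : nat) Q :=
  exists t s', [/\ exec O c s t s', (t <= T)%N & Q s'].

Lemma reaches_weaken c s T T' Q Q' :
  reaches c s T Q -> (T <= T')%N -> (forall s', Q s' -> Q' s') ->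
  reaches c s T' Q'.
Proof.
move=> [t [s' [e tT Qs']]] TT' QQ'; exists t, s'.
by split=> //; [exact: leq_trans TT'|exact: QQ'].
Qed.

Lemma reaches_leq c s T T' Q :
  reaches c s T Q -> (T <= T')%N -> reaches c s T' Q.
Proof. by move=> H TT'; exact: reaches_weaken H TT' _. Qed.

Lemma reaches_exec c s t s' Q : exec O c s t s' -> Q s' -> reaches c s t Q.
Proof. by move=> e Qs'; exists t, s'. Qed.

Lemma reaches_seq c1 c2 s T1 T2 Q1 Q :
  reaches c1 s T1 Q1 -> (forall s1, Q1 s1 -> reaches c2 s1 T2 Q) ->
  reaches (Seq c1 c2) s (T1 + T2) Q.
Proof.
move=> [t1 [s1 [e1 le1 /[swap] /[apply] [[t2 [s2 [e2 le2 Qs2]]]]]]].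
by exists (t1 + t2)%N, s2; split; [exact: ExSeq e1 e2|exact: leq_add|].
Qed.

Lemma reaches_if b c1 c2 s T Q :
  (beval s b -> reaches c1 s T Q) -> (~~ beval s b -> reaches c2 s T Q) ->
  reaches (If b c1 c2) s (bcost b + T).+1 Q.
Proof.
move=> H1 H2; case: (boolP (beval s b)) => sb.
  have [t [s' [e le Qs']]] := H1 sb; exists (bcost b + t).+1, s'.
  by split; [exact: ExIfTrue|rewrite ltnS leq_add2l|].
have [t [s' [e le Qs']]] := H2 sb; exists (bcost b + t).+1, s'.
by split; [exact: ExIfFalse|rewrite ltnS leq_add2l|].
Qed.

(** The invariant is indexed by the number of completed rounds. [N] only bounds that number, which
    suits a guard on reals: a true guard must force [i < N]. *)
Lemma reaches_while (Inv : nat -> state R -> Prop) b c (N T j : nat) s :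
  (forall i s1, Inv i s1 -> beval s1 b ->
    (i < N)%N /\ reaches c s1 T (Inv i.+1)) ->
  Inv j s ->
  reaches (While b c) s ((N - j) * (bcost b + T).+1 + (bcost b).+1)
    (fun s' => ~~ beval s' b /\ exists i, Inv i s').
Proof.
move=> step; have [k] := ubnP (N - j); elim: k j s => // k IH j s Nj Ijs.
case: (boolP (beval s b)) => sb; last first.
  exists (bcost b).+1, s.
  by split; [exact: ExWhileFalse|exact: leq_addl|split=> //; exists j].
have [jN [t1 [s1 [e1 le1 I1]]]] := step _ _ Ijs sb.
have Nj1 : (N - j.+1 < k)%N by lia.
have [t2 [s2 [e2 le2 Q2]]] := IH _ _ Nj1 I1.
exists (bcost b + t1 + t2).+1, s2; split => //.
  exact: ExWhileTrue e1 e2.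
have -> : (N - j = (N - j.+1).+1)%N by lia.
by rewrite mulSn; lia.
Qed.

Lemma reaches_for (Inv : nat -> (nat -> R) -> (nat -> R) -> Prop)
    c (T : nat) s :
  ireg s 0%N = n -> Inv 0%N (rreg s) (mem s) ->
  (forall i s1, (i < n)%N -> ireg s1 0%N = n -> ireg s1 1%N = i ->
    Inv i (rreg s1) (mem s1) ->
    reaches c s1 T
      (fun s2 => ireg s2 = ireg s1 /\ Inv i.+1 (rreg s2) (mem s2))) ->
  reaches (for_loop c) s (n * (T + 8) + 6)%N
    (fun s' => ireg s' 0%N = n /\ Inv n (rreg s') (mem s')).
Proof.
move=> s0 I0 step.
pose J i s1 := [/\ ireg s1 0%N = n, ireg s1 1%N = i, (i <= n)%N &
  Inv i (rreg s1) (mem s1)].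
(* Incrementing the counter costs 4, and the guard with its loop step another 4: hence [T + 8] per
   round. Initialization and the last test give 2 + 4. *)
have H := @reaches_while J (BIlt (IVar 1) (IVar 0))
  (Seq c (ISet 1 (IAdd (IVar 1) (ICst 1)))) n (T + 4)%N 0%N.
apply: reaches_weaken; first (apply: reaches_seq;
    first by apply: reaches_exec; [exact: ExISet|exact: (erefl _)]).
- move=> _ <-; apply: H; last by split.
  move=> i s1 [s10 s11 _ I1] /=; rewrite s10 s11 => i_lt; split=> //.
  apply: (reaches_seq (step i s1 i_lt s10 s11 I1)) => s2 [s21 I2].
  apply: reaches_exec; first exact: ExISet.
  by split=> //=; rewrite s21 ?s10 ?s11 ?addn1.
- rewrite subn0 /=; lia.
- move=> s' [/= +] [i [s'0 s'1 le I']]; rewrite s'0 s'1 -leqNgt => ge.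
  by split=> //; have <- : i = n by apply/eqP; rewrite eqn_leq le ge.
Qed.

Lemma get_vec_set_vec s a (x : 'rV[R]_n) : get_vec n (set_vec s a x) a = x.
Proof.
apply/rowP => i; rewrite mxE /= leq_addr addKn.
by case: insubP => [j _ /val_inj -> //|]; rewrite ltn_ord.
Qed.

Lemma mem_set_vec s a (x : 'rV[R]_n) k :
  (k < a)%N || (a + n <= k)%N -> mem (set_vec s a x) k = mem s k.
Proof.
move=> /= ka; case: leqP => // ak; case: insubP => // j jn; lia.
Qed.

Lemma eq_get_vec s s' a :
  (forall k, (a <= k < a + n)%N -> mem s k = mem s' k) ->
  get_vec n s a = get_vec n s' a.
Proof.
by move=> H; apply/rowP => i; rewrite !mxE H // leq_addr ltn_add2l ltn_ord.
Qed.

Lemma ieval_base s k : ireg s 0%N = n -> ieval s (base k) = (k * n)%N.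
Proof. by move=> s0; elim: k => //= k ->; rewrite s0 mulSn. Qed.

End ProgramLogic.

(* Memory layout: the cells from [0], [n], [2n] and [3n] on hold the best point
   found so far, the current iterate, its gradient and the linear optimizer in
   that direction.  The real registers [0] to [4] hold delta, the accumulated
   sum of [delta ^ 2], the gap of the iterate, [1 / (1 + gap)], and the largest
   value of [1 / (1 + gap)] so far; gaps are nonnegative, so that the initial
   value [0] of the last one stands for an infinite gap. *)

Definition query : cmd :=
  Seq (CallGrad (base 2) (base 1)) (CallLin (base 3) (base 2)).

Definition compute_gap : cmd :=
  Seq (RSet 2 (RCst 0)) (for_loop (RSet 2 (RAdd (RVar 2)
    (RMul (RSub (RMem (addr 3)) (RMem (addr 1))) (RMem (addr 2)))))).

Definition copy_iterate : cmd := for_loop (Store (addr 0) (RMem (addr 1))).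

Definition update_best : cmd :=
  Seq (RSet 3 (RDiv (RCst 1) (RAdd (RCst 1) (RVar 2))))
    (If (BRlt (RVar 4) (RVar 3)) (Seq copy_iterate (RSet 4 (RVar 3))) Skip).

Definition move_iterate : cmd :=
  for_loop (Store (addr 1) (RAdd (RMem (addr 1))
    (RMul (RVar 0) (RSub (RMem (addr 3)) (RMem (addr 1)))))).

Definition fw_step : cmd :=
  Seq query (Seq compute_gap (Seq update_best (Seq move_iterate
    (RSet 1 (RAdd (RVar 1) (RMul (RVar 0) (RVar 0))))))).

(** The first call reads zeroed cells: optimizing the zero functional yields a starting point in the
    body. Summing delta^2 up to 1 counts delta^-2 rounds without rounding a real to an integer. *)
Definition frank_wolfe : cmd :=
  Seq (CallLin (base 1) (base 0)) (While (BRlt (RVar 1) (RCst 1)) fw_step).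

(** * Effect and cost of one iteration *)

Section FrankWolfeStep.
Variables (R : realType) (n : nat) (O : oracles R n).
Implicit Types s : state R.

Lemma reaches_query s : ireg s 0%N = n -> cube (get_vec n s n) ->
  let g := orGrad O (get_vec n s n) in
  reaches O query s (2 * n + 22) (fun s' =>
    [/\ ireg s' 0%N = n, rreg s' = rreg s,
        forall k, (k < 2 * n)%N -> mem s' k = mem s k,
        get_vec n s' (2 * n) = g & get_vec n s' (3 * n) = orLin O g]).
Proof.
move=> s0 cx g.
have b1 : ieval s (base 1) = n by rewrite (ieval_base _ s0) mul1n.
have b2 : ieval s (base 2) = (2 * n)%N by rewrite (ieval_base _ s0).
apply: reaches_leq; first apply: (reaches_seq (Q1 :=
  fun s1 => s1 = set_vec s (2 * n) g)).
- have := @ExCallGrad _ _ O s (base 2) (base 1); rewrite b1 b2 => /(_ cx) e.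
  exact: reaches_exec e _.
- move=> s1 ->; apply: reaches_exec; first exact: ExCallLin.
  set s1' := set_vec s (2 * n) g.
  have s10 : ireg s1' 0%N = n by [].
  rewrite !(ieval_base _ s10) get_vec_set_vec; split=> //.
  + move=> k kn; rewrite !mem_set_vec //; lia.
  + rewrite -[RHS](get_vec_set_vec s (2 * n)); apply: eq_get_vec => k kn.
    by rewrite mem_set_vec //; lia.
  + by rewrite get_vec_set_vec.
- rewrite /=; lia.
Qed.

Lemma reaches_compute_gap s : ireg s 0%N = n ->
  reaches O compute_gap s (n * 40 + 10) (fun s' =>
    [/\ ireg s' 0%N = n, mem s' = mem s,
        forall v, v != 2%N -> rreg s' v = rreg s v &
        rreg s' 2%N =
          dotv (get_vec n s (3 * n) - get_vec n s n) (get_vec n s (2 * n))]).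
Proof.
move=> s0.
pose f j := (mem s (3 * n + j) - mem s (n + j)) * mem s (2 * n + j).
pose Inv i r m := [/\ m = mem s, forall v, v != 2%N -> r v = rreg s v &
  r 2%N = \sum_(j < i) f j].
apply: reaches_weaken; first apply: (reaches_seq (Q1 :=
  eq (set_rreg s 2 (reval s (RCst 0))))).
- by apply: reaches_exec; first exact: ExRSet.
- move=> _ <-; apply: (reaches_for (Inv := Inv)) => //.
    by split=> //= [v /negPf ->//|]; rewrite big_ord0.
  move=> i s1 i_lt s10 s11 [m1 r1 r12].
  apply: reaches_exec; first exact: ExRSet.
  split=> //; split=> //= [v v2|]; first by rewrite (negPf v2) r1.
  rewrite s10 s11 r12 m1 big_ord_recr /f /=.
  have -> : (n + (n + (n + i)) = 3 * n + i)%N by lia.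
  by have -> : (n + (n + i) = 2 * n + i)%N by lia.
- rewrite /=; lia.
- move=> s' [s'0 [m' r' r'2]]; split=> //.
  by rewrite r'2; apply: eq_bigr => i _; rewrite !mxE.
Qed.

Lemma reaches_copy_iterate s : ireg s 0%N = n ->
  reaches O copy_iterate s (n * 20 + 10) (fun s' =>
    [/\ ireg s' 0%N = n, rreg s' = rreg s, get_vec n s' 0 = get_vec n s n &
        forall k, (n <= k)%N -> mem s' k = mem s k]).
Proof.
move=> s0.
pose Inv i (r m : nat -> R) := r = rreg s /\
  forall k, m k = if (k < i)%N then mem s (n + k)%N else mem s k.
apply: reaches_weaken; first apply: (reaches_for (Inv := Inv)) => //.
- move=> i s1 i_lt s10 s11 [r1 m1].
  apply: reaches_exec; first exact: ExStore.
  split=> //; split=> //= k; rewrite s10 s11 (m1 (n + i)%N) (m1 k) ltnS.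
  (* The source cell has not been overwritten. *)
  have -> : (n + i < i)%N = false by lia.
  by case: ltngtP => [||->].
- rewrite /=; lia.
- move=> s' [s'0 [r' m']]; split=> //.
    by apply/rowP => i; rewrite !mxE m' ltn_ord.
  by move=> k; rewrite m' ltnNge => ->.
Qed.

Lemma reaches_update_best s : ireg s 0%N = n ->
  let w := 1 / (1 + rreg s 2%N) in
  reaches O update_best s (n * 20 + 30) (fun s' =>
    [/\ ireg s' 0%N = n,
        rreg s' 0%N = rreg s 0%N /\ rreg s' 1%N = rreg s 1%N,
        forall k, (n <= k)%N -> mem s' k = mem s k &
        if rreg s 4%N < w
        then get_vec n s' 0 = get_vec n s n /\ rreg s' 4%N = w
        else get_vec n s' 0 = get_vec n s 0 /\ rreg s' 4%N = rreg s 4%N]).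
Proof.
move=> s0 w.
apply: reaches_leq; first apply: (reaches_seq (Q1 := eq (set_rreg s 3 w))).
- by apply: reaches_exec; first exact: ExRSet.
- move=> _ <-; set s1 := set_rreg _ _ _.
  (* The copy takes at most [n * 20 + 10] steps and the register update 2. *)
  apply: (reaches_if (T := (n * 20 + 12)%N)) => /= H; last first.
    apply: (reaches_weaken (Q := eq s1)).
      exact: reaches_exec (ExSkip _ _) _.
      by rewrite addnS.
    by move=> _ <-; rewrite (negPf H).
  apply: reaches_leq.
  + apply: (reaches_seq (reaches_copy_iterate (s := s1) _)) => //.
    move=> s2 [s20 r2 v2 m2]; apply: reaches_exec; first exact: ExRSet.
    by rewrite H; split=> //=; rewrite ?r2.
  + rewrite /=; lia.
- rewrite /=; lia.
Qed.

Lemma reaches_move_iterate s : ireg s 0%N = n ->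
  reaches O move_iterate s (n * 40 + 10) (fun s' =>
    [/\ ireg s' 0%N = n, rreg s' = rreg s,
        get_vec n s' n = get_vec n s n
          + rreg s 0%N *: (get_vec n s (3 * n) - get_vec n s n) &
        forall k, (k < n)%N -> mem s' k = mem s k]).
Proof.
move=> s0.
(* For k = n + j, a cell of the iterate, 2n + k is the matching cell 3n + j of the linear
   optimizer. *)
pose Inv i (r m : nat -> R) := r = rreg s /\
  forall k, m k = if (n <= k < n + i)%N
    then mem s k + rreg s 0%N * (mem s (2 * n + k)%N - mem s k) else mem s k.
apply: reaches_weaken; first apply: (reaches_for (Inv := Inv)) => //.
- by split=> // k; case: ifP => //; lia.
- move=> i s1 i_lt s10 s11 [r1 m1].
  apply: reaches_exec; first exact: ExStore.
  split=> //; split=> //= k; rewrite s10 s11 r1 !m1.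
  have -> : (n <= n + (n + (n + i)) < n + i)%N = false by lia.
  have -> : (n <= n + i < n + i)%N = false by lia.
  case: eqP => [->|ne].
    by rewrite leq_addr addnS ltnSn /= mulSn mul1n addnA.
  by congr (if _ then _ else _); lia.
- rewrite /=; lia.
- move=> s' [s'0 [r' m']]; split=> //.
    apply/rowP => i; rewrite !mxE m' leq_addr ltn_add2l ltn_ord /=.
    by rewrite addnA -mulSnr.
  by move=> k kn; rewrite m' leqNgt kn.
Qed.

Lemma reaches_fw_step s : ireg s 0%N = n -> cube (get_vec n s n) ->
  let x := get_vec n s n in
  let g := orGrad O x in
  let w := 1 / (1 + dotv (orLin O g - x) g) in
  let delta := rreg s 0%N in
  reaches O fw_step s (n * 120 + 100) (fun s' =>
    [/\ ireg s' 0%N = n,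
        rreg s' 0%N = delta /\ rreg s' 1%N = rreg s 1%N + delta * delta,
        get_vec n s' n = x + delta *: (orLin O g - x) &
        if rreg s 4%N < w
        then get_vec n s' 0 = x /\ rreg s' 4%N = w
        else get_vec n s' 0 = get_vec n s 0 /\ rreg s' 4%N = rreg s 4%N]).
Proof.
move=> s0 cx x g w delta.
apply: reaches_leq.
- apply: (reaches_seq (reaches_query s0 cx)) => s1 [s10 r1 m1 g1 l1].
  have x1 : get_vec n s1 n = x by apply: eq_get_vec => k kn; apply: m1; lia.
  have o1 : get_vec n s1 0 = get_vec n s 0.
    by apply: eq_get_vec => k kn; apply: m1; lia.
  apply: (reaches_seq (reaches_compute_gap s10)) => s2 [s20 m2 r2 r22].
  apply: (reaches_seq (reaches_update_best s20)) => s3 [s30 [r30 r31] m3 b3].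
  apply: (reaches_seq (reaches_move_iterate s30)) => s4 [s40 r4 x4 m4].
  apply: reaches_exec; first exact: ExRSet.
  have x3 a : (n <= a)%N -> get_vec n s3 a = get_vec n s1 a.
    by move=> an; apply: eq_get_vec => k kn; rewrite m3 ?m2 //; lia.
  have o4 : get_vec n s4 0 = get_vec n s3 0.
    by apply: eq_get_vec => k kn; rewrite m4 //; lia.
  have e2 a : get_vec n s2 a = get_vec n s1 a.
    by apply: eq_get_vec => k _; rewrite m2.
  split=> //=.
  + by rewrite r4 r30 r31 !r2 // r1.
  + rewrite -[LHS]/(get_vec n s4 n) x4 !x3 ?l1 ?x1 ?r30 ?r2 ?r1 //; lia.
  + rewrite -[get_vec _ _ _]/(get_vec n s4 0) o4 r4.
    by move: b3; rewrite r22 l1 x1 g1 !e2 x1 o1 !r2 // r1.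
- rewrite /=; lia.
Qed.

End FrankWolfeStep.

(** * The Frank-Wolfe algorithm *)

(** Translates comparisons of the stored weights 1 / (1 + gap) into comparisons of gaps. *)
Lemma ltr_div1D (R : realType) (a b : R) :
  0 <= a -> 0 <= b -> (1 / (1 + a) < 1 / (1 + b)) = (b < a).
Proof.
by move=> a0 b0; rewrite !div1r ltf_pV2 ?ltrD2l // posrE ltr_pwDl.
Qed.

Section FrankWolfe.
Variables (R : realType) (n : nat).
Variables (F : 'rV[R]_n -> R) (g : 'rV[R]_n -> 'rV[R]_n).
Variables (L : R) (P : set 'rV[R]_n) (lin : 'rV[R]_n -> 'rV[R]_n) (D : R).
Hypotheses (F_ge0 : forall x, cube x -> 0 <= F x) (Fg : is_gradient F g).
Hypotheses (L_ge0 : 0 <= L) (gL : L_smooth g L).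
Hypotheses (Pbody : convex_body P) (Pcube : P `<=` cube).
Hypotheses (Plin : linear_optimizer P lin) (PD : has_diameter P D).

Let gap x := dotv (lin (g x) - x) (g x).

Lemma gap_ge x y : P y -> dotv (y - x) (g x) <= gap x.
Proof.
move=> Py; rewrite /gap !dotvBl lerD2r !(dotvC _ (g x)).
by have [_] := Plin (g x); apply.
Qed.

Lemma gap_ge0 x : P x -> 0 <= gap x.
Proof.
by move=> /(gap_ge x); apply: le_trans; rewrite dotvBl subrr.
Qed.

Lemma convex_body_segment x y (t : R) :
  P x -> P y -> 0 <= t <= 1 -> P (x + t *: (y - x)).
Proof.
move=> Px Py /andP[t0 t1]; have [_ _ cP] := Pbody.
have := cP y x (Itv01 t0 t1) (mem_set Py) (mem_set Px).
rewrite inE; congr P; rewrite /conv /= /unstable.onem scalerBl scale1r scalerBr.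
by rewrite addrCA.
Qed.

Lemma fw_progress x (t : R) : P x -> 0 <= t <= 1 ->
  t * gap x - t ^+ 2 * (D ^+ 2 * L / 2) <= F (x + t *: (lin (g x) - x)) - F x.
Proof.
move=> Px t01; set y := lin (g x); have Py : P y by have [] := Plin (g x).
have Pxt := convex_body_segment Px Py t01.
have := L_smooth_lower_bound Fg L_ge0 gL (Pcube Px) (Pcube Pxt).
rewrite dotvZr norm2Z dotvC -/(gap x) exprMn real_normK ?num_real //.
have N0 := norm2_ge0 (y - x); have ND := PD Py Px.
have NN : norm2 (y - x) ^+ 2 <= D ^+ 2.
  by rewrite lerXn2r ?nnegrE // (le_trans N0).
move=> /(le_trans _); apply; rewrite lerB // mulrCA.
rewrite [X in _ <= X](_ : _ = t ^+ 2 * (L / 2 * D ^+ 2)); last by ring.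
by rewrite !ler_wpM2l ?sqr_ge0 // divr_ge0.
Qed.

Variables (M delta : R).
Hypotheses (MP : is_max_on P F M) (delta01 : 0 < delta < 1).

Let B := delta * (M + D ^+ 2 * L / 2).

(** In the time bound, [n + 5] pays for the initial oracle call, [n * 120 + 104] for a round with
    its guard, and 4 for the final test. *)
Lemma frank_wolfe_reaches (N : nat) : delta ^- 2 < N%:R ->
  reaches (Oracles F g lin) frank_wolfe (init_state n delta)
    (n + 5 + (N * (n * 120 + 104) + 4))
    (fun s => P (output n s) /\ gap (output n s) <= B).
Proof.
have /andP[d0 d1] := delta01 => N_big.
have M0 : 0 <= M.
  by have [[y Py <-] _] := MP; exact: F_ge0 (Pcube Py).
have B0 : 0 <= B.
  by rewrite mulr_ge0 ?(ltW d0) // addr_ge0 // divr_ge0 // mulr_ge0 ?sqr_ge0.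
have d01 : 0 <= delta <= 1 by rewrite !ltW.
(* Either the best gap so far is small or [F] has grown by the guaranteed amount. The growth must be
   strict to contradict maximality at the end even if M = 0; at j = 0 only F >= 0 is known and no
   point is recorded, so that case is separate. *)
pose Inv j (s : state R) := [/\ ireg s 0%N = n, rreg s 0%N = delta,
  rreg s 1%N = j%:R * (delta * delta), P (get_vec n s n) &
  if j is 0 then rreg s 4%N = 0
  else [/\ P (get_vec n s 0), rreg s 4%N = 1 / (1 + gap (get_vec n s 0)) &
    gap (get_vec n s 0) <= B \/
    j%:R * (delta * delta) * M < F (get_vec n s n)]].
apply: reaches_weaken; first apply: (reaches_seq (Q1 := Inv 0%N)).
- apply: reaches_exec; first exact: ExCallLin.
  rewrite /Inv mul0r (ieval_base (n := n)) // mul1n; split=> //.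
  by rewrite get_vec_set_vec; have [] := Plin (get_vec n (init_state n delta)
    (ieval (init_state n delta) (base 0))).
- move=> s; apply: (reaches_while (N := N) (T := (n * 120 + 100)%N)).
  move=> j s1 [s10 r0 r1 Px best] /=; rewrite r1 => acc_lt; split.
    (* A true guard says j delta^2 < 1, hence j < delta^-2 < N. *)
    rewrite -(ltr_nat R) -(ltr_pM2r (mulr_gt0 d0 d0)).
    apply: lt_trans acc_lt _; rewrite -ltr_pdivrMr ?mulr_gt0 // mul1r.
    by rewrite -expr2.
  set x := get_vec n s1 n in Px best *.
  apply: reaches_weaken; first exact: (reaches_fw_step _ s10 (Pcube Px)).
    by [].
  move=> s2 [s20 [r20 r21] x2 best2] /=.
  have Px2 : P (get_vec n s2 n).
    rewrite x2 r0; apply: convex_body_segment => //.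
    by have [] := Plin (g x).
  have gx0 := gap_ge0 Px.
  split=> //; first by rewrite r20.
    by rewrite r21 r1 r0 -[j.+1]addn1 natrD mulrDl mul1r.
  have prog : gap x <= B \/ j.+1%:R * (delta * delta) * M < F (get_vec n s2 n)
      \/ (0 < j)%N /\ gap (get_vec n s1 0) <= B.
    have [|big] := lerP (gap x) B; first by left.
    right; have fw := fw_progress Px d01.
    (* A gap above B gains more than delta B - delta^2 D^2 L / 2 = delta^2 M. *)
    have inc : delta * delta * M < F (get_vec n s2 n) - F x.
      rewrite x2 r0; apply: lt_le_trans fw.
      have := ltr_pM2l d0 B (gap x); rewrite big /B; nra.
    rewrite -[j.+1]addn1 natrD !mulrDl mul1r.
    case: (j) best => [_|j' [_ _ [|Fx]]]; [left|by right|left].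
      by rewrite !mul0r add0r; have := F_ge0 (Pcube Px); lra.
    lra.
  move: best2; rewrite /= -/(gap x) -/x.
  have [lt_w [-> r24]|ge_w [-> r24]] := ltP.
    split=> //; case: prog => [|[|[j_gt0 oldB]]]; [by left|by right|left].
    case: j j_gt0 best lt_w {r1 acc_lt r21} => // j _ [Pb -> _].
    have gb0 := gap_ge0 Pb.
    by rewrite ltr_div1D // => /ltW /le_trans; apply.
  (* In the first round the stored 0 is below the positive weight of the iterate, which is therefore
     recorded. *)
  have j_gt0 : (0 < j)%N.
    case: (j) best => // r4; move: ge_w; rewrite r4 leNgt divr_gt0 //.
    by rewrite ltr_wpDr.
  case: j j_gt0 best prog {r1 acc_lt r21} => // j _ [Pb r4 _] prog.
  have gb0 := gap_ge0 Pb.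
  rewrite r24; split=> //; case: prog => [xB|[|[_]]]; [left|by right|by left].
  by move: ge_w; rewrite r4 leNgt ltr_div1D // -leNgt => /le_trans; apply.
- rewrite /= subn0; lia.
- move=> s [/=]; rewrite -leNgt => acc_ge [j [_ _ r1 Px best]].
  case: j r1 best => [r1 _|j r1 [Pb _ [//|FM]]].
    by move: acc_ge; rewrite r1 mul0r ler10.
  (* At exit j delta^2 >= 1, so the growth alternative would give F > M at a point of the body. *)
  have [_ /(_ _ Px) FxM] := MP; exfalso.
  move: acc_ge; rewrite r1 => acc_ge.
  have := ler_wpM2r M0 acc_ge; rewrite mul1r => H.
  by have := lt_le_trans FM (le_trans FxM H); rewrite ltxx.
Qed.

End FrankWolfe.

(** * Attained maxima, the time bound and the conclusion *)

Lemma is_max_on_gradient (R : realType) (n : nat) (F : 'rV[R]_n -> R) g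
    (P : set 'rV[R]_n) :
  is_gradient F g -> convex_body P -> P `<=` cube -> exists M, is_max_on P F M.
Proof.
move=> Fg [P0 cP _] Pcube; apply: exists_is_max_on => //.
apply: within_continuousP => x Px e e0.
have := is_gradient_continuous Fg (Pcube _ Px) e0.
by apply: filterS => y H /Pcube.
Qed.

Lemma is_max_on_vee_wedge (R : realType) (n : nat) (F : 'rV[R]_n -> R) g
    (P : set 'rV[R]_n) x :
  is_gradient F g -> convex_body P -> P `<=` cube -> cube x ->
  exists M, is_max_on P (fun y => F (vee x y) + F (wedge x y)) M.
Proof.
move=> Fg [P0 cP _] Pcube cx; apply: exists_is_max_on => //.
have vee_cont : continuous (vee x).
  apply: nonexpansive_continuous => y z i; rewrite !mxE.
  have /andP[] : - `|y 0 i - z 0 i| <= y 0 i - z 0 i <= `|y 0 i - z 0 i|.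
    by rewrite -ler_norml.
  rewrite ler_norml.
  by rewrite /Num.max; do 2 case: ltP => ?; lra.
have wedge_cont : continuous (wedge x).
  apply: nonexpansive_continuous => y z i; rewrite !mxE.
  have /andP[] : - `|y 0 i - z 0 i| <= y 0 i - z 0 i <= `|y 0 i - z 0 i|.
    by rewrite -ler_norml.
  rewrite ler_norml.
  by rewrite /Num.min; do 2 case: ltP => ?; lra.
apply: within_continuousP => y Py e e0; have cy := Pcube _ Py.
have e2 : 0 < e / 2 by rewrite divr_gt0.
have Hv := vee_cont _ _ (is_gradient_continuous Fg (cube_vee cx cy) e2).
have Hw := wedge_cont _ _ (is_gradient_continuous Fg (cube_wedge cx cy) e2).
near=> z => /Pcube cz.
have : `|F (vee x z) - F (vee x y)| <= e / 2.
  by have := cube_vee cx cz; near: z; exact: Hv.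
have : `|F (wedge x z) - F (wedge x y)| <= e / 2.
  by have := cube_wedge cx cz; near: z; exact: Hw.
rewrite !ler_norml; lra.
Unshelve. all: by end_near. Qed.

(** With X = n + 1/delta >= 1, the number of rounds is at most 2 X^2 and a round costs at most 224
    X, giving 448 X^3. The remaining n + 9 is at most 10 X^3. *)
Lemma frank_wolfe_time (R : realType) (n : nat) (delta : R) :
  0 < delta < 1 ->
  (n + 5 + ((Num.truncn (delta ^- 2)).+1 * (n * 120 + 104) + 4))%N%:R
    <= 458%:R * (n%:R + delta^-1) ^+ 3.
Proof.
move=> /andP[d0 d1].
have : (Num.truncn (delta ^- 2))%:R <= delta ^- 2.
  by rewrite truncn_le // invr_ge0 sqr_ge0.
rewrite -exprVn; set N := Num.truncn _; set D := delta^-1 => ND.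
have D1 : 1 <= D by rewrite /D invf_ge1 // ltW.
have n0 : 0 <= (n%:R : R) by [].
rewrite !(natrD, natrM) -[N.+1]addn1 natrD.
set X := n%:R + D.
have X1 : 1 <= X by rewrite /X; lra.
have X2 : X <= X ^+ 2 by rewrite expr2; nra.
have X3 : X ^+ 2 <= X ^+ 3 by rewrite [X ^+ 3]exprS; nra.
have NX : N%:R + 1 <= 2 * X ^+ 2 by rewrite /X; nra.
have nX : n%:R * 120%:R + 104%:R <= 224 * X by rewrite /X; lra.
have : (N%:R + 1) * (n%:R * 120%:R + 104%:R) <= (2 * X ^+ 2) * (224 * X).
  by apply: ler_pM => //; rewrite addr_ge0 // mulr_ge0.
have -> : 2 * X ^+ 2 * (224 * X) = 448%:R * X ^+ 3 by ring.
have : n%:R <= X by rewrite /X; lra.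
lra.
Qed.

Theorem theorem2p4 :
  exists (A : cmd) (c k : nat),
  forall (R : realType) (n : nat)
    (F : 'rV[R]_n -> R) (gradF : 'rV[R]_n -> 'rV[R]_n) (L : R)
    (P : set 'rV[R]_n) (lin : 'rV[R]_n -> 'rV[R]_n) (D delta : R),
  (forall x, cube x -> 0 <= F x) ->
  is_gradient F gradF ->
  0 <= L -> L_smooth gradF L ->
  convex_body P -> P `<=` cube -> linear_optimizer P lin ->
  has_diameter P D ->
  0 < delta < 1 ->
  exists2 M : R, is_max_on P F M &
  let near_stationary (x : 'rV[R]_n) :=
    forall y, P y ->
      dotv (y - x) (gradF x) <= delta * (M + D ^+ 2 * L / 2) in
  (exists (t : nat) (s : state R),
    [/\ exec (Oracles F gradF lin) A (init_state n delta) t s,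
        t%:R <= c%:R * (n%:R + delta^-1) ^+ k,
        P (output n s) &
        near_stationary (output n s)]) /\
  (DR_submodular F ->
   forall x : 'rV[R]_n, P x -> near_stationary x ->
   exists2 M' : R,
     is_max_on P (fun y => F (vee x y) + F (wedge x y)) M' &
     F x >= 1 / 2 * M' - delta * (2 * M + D ^+ 2 * L) / 4).
Proof.
exists frank_wolfe, 458%N, 3%N.
move=> R n F g L P lin D delta F_ge0 Fg L_ge0 gL Pbody Pcube Plin PD delta01.
have [M MP] := is_max_on_gradient Fg Pbody Pcube.
exists M => // near_stationary; split.
  have N_big : delta ^- 2 < (Num.truncn (delta ^- 2)).+1%:R.
    by rewrite truncnS_gt.
  have [t [s [run t_le [Ps gap_le]]]] := frank_wolfe_reaches F_ge0 Fg L_ge0 gL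
    Pbody Pcube Plin PD MP delta01 N_big.
  exists t, s; split=> //.
    by apply: le_trans (frank_wolfe_time n delta01); rewrite ler_nat.
  by move=> y Py; apply: le_trans gap_le; exact: gap_ge.
move=> DR x Px statx; have cx := Pcube _ Px.
have [M' [[y Py yM'] maxM']] := is_max_on_vee_wedge Fg Pbody Pcube cx.
exists M'; first by split=> //; exists y.
(* Applied at the maximizer [y], near stationarity gives M' - 2 F x <= delta (M + D^2 L / 2);
   halving gives the claim. *)
have := DR_submodular_vee_wedge Fg DR cx (Pcube _ Py).
have := statx _ Py; rewrite -yM'; lra.
Qed.
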